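(* Let $K \ge 2$, let $\mathcal{X}$ be a set of inputs, let $\mathcal{T}, \mathcal{P}_+, \mathcal{P}_- : \mathcal{X} \to \mathbb{R}^K$ be functions (teacher logits and logits of two proxy clones), and let $\varepsilon > 0$, $\lambda \ge 0$, $m > 0$ be real numbers. For an input $\mathbf{x}$ let $\mathbf{z}=\mathcal{T}(\mathbf{x})$, $\mathbf{p}_{\mathcal{T}} = \sigma(\mathbf{z})$, and let $\hat{\mathbf{p}}$ be the served vector, $\lambda(\mathbf{x})$ the per-input budget, and $\mathrm{gap}_j$ the margins, all produced by the ADS-C procedure described in the context. Then for every $\mathbf{x}\in\mathcal{X}$ such that the maximum of $z_1,\dots,z_K$ is attained at a unique index $t$: (i) For all $j \ne t$, $$\log \hat p_t - \log \hat p_j \;\ge\; \min\bigl(m, \mathrm{gap}_j\bigr) \;>\; 0.$$ (ii) Consequently $\arg\max_k \hat p_k = \arg\max_k p_{\mathcal{T},k}$ (both equal $t$). In particular, this holds deterministically for each query, so the top-1 accuracy of $\hat{\mathbf{p}}$ equals the top-1 accuracy of $\mathbf{p}_{\mathcal{T}}$ identically: for every finite nonempty labeled collection $(\mathbf{x}_i,y_i)_{i=1}^N$ of inputs $\mathbf{x}_i$ with unique teacher argmax and labels $y_i\in\{1,\dots,K\}$, the fraction of $i$ with $\arg\max_k \hat p_k(\mathbf{x}_i) = y_i$ equals the fraction of $i$ with $\arg\max_k p_{\mathcal{T},k}(\mathbf{x}_i) = y_i$. (iii) $\lambda(\mathbf{x})$ is maximal: it is the largest $\lambda' \in [0,\lambda]$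 such that the vector $\hat{\mathbf{p}}^{(\lambda')} = \sigma\bigl(\log \sigma(\mathbf{z}) + \lambda' \widehat{\Delta}\bigr)$ satisfies $\log \hat p^{(\lambda')}_t - \log \hat p^{(\lambda')}_j \ge \min(m,\mathrm{gap}_j)$ for all $j \neq t$.
   Context: The softmax $\sigma:\mathbb{R}^K\to\mathbb{R}^K$ is $\sigma(\mathbf{z})_i = \exp(z_i)/\sum_j \exp(z_j)$; $\log$ of a vector is taken coordinatewise. The ADS-C procedure, on input $\mathbf{x}$ with step $\varepsilon>0$, requested strength $\lambda\ge 0$ and margin floor $m>0$: 1. Compute the teacher logits $\mathbf{z} = \mathcal{T}(\mathbf{x})\in\mathbb{R}^K$ and the top class $t = \arg\max_k z_k$. 2. Compute the penalty vector $\widehat{\Delta} = \bigl[\log\sigma(\mathcal{P}_+(\mathbf{x})) - \log\sigma(\mathcal{P}_-(\mathbf{x}))\bigr]/(2\varepsilon) \in \mathbb{R}^K$, with coordinates $\widehat{\Delta}_1,\dots,\widehat{\Delta}_K$. 3. For each $j\neq t$ set $\mathrm{gap}_j = z_t - z_j$ and $c_j = \widehat{\Delta}_j - \widehat{\Delta}_t$. 4. Set the per-input budget $$\lambda(\mathbf{x}) = \operatorname{clip}\Bigl(\min_{j\ne t:\, c_j>0} \frac{\mathrm{gap}_j - m}{c_j},\; 0,\; \lambda\Bigr),$$ where $\operatorname{clip}(a,0,\lambda) = \min(\max(a,0),\lambda)$ and a minimum over the empty set is $+\infty$ (so that $\lambda(\mathbf{x}) = \lambda$ in that case). 5. Return the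 served vector $\hat{\mathbf{p}} = \hat{\mathbf{p}}(\mathbf{x}) = \sigma\bigl(\log\sigma(\mathbf{z}) + \lambda(\mathbf{x})\,\widehat{\Delta}\bigr)$. The top-1 accuracy of a vector-valued predictor is the fraction of labeled inputs on which the index of its largest coordinate equals the label. *)

(* Defs.v *)
From HB Require Import structures.
From mathcomp Require Import all_boot all_order all_algebra.
From mathcomp Require Import mathcomp_extra boolp classical_sets reals.
From mathcomp Require Import constructive_ereal sequences exp.

Set Implicit Arguments.
Unset Strict Implicit.
Unset Printing Implicit Defensive.
Import Order.TTheory GRing.Theory Num.Theory.
Local Open Scope ring_scope.

Section Vectors.
Variables (R : realType) (K : nat).
Implicit Types v : 'rV[R]_K.

Definition softmax v : 'rV[R]_K :=
  \row_i (expR (v 0 i) / \sum_j expR (v 0 j)).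

Definition logv v : 'rV[R]_K := map_mx (@ln R) v.

(* All maximizers: the maximum is attained only at t iff argmax v = [set t]. *)
Definition argmax v : {set 'I_K} := [set k | [forall j, v 0 j <= v 0 k]].

(* The index selected by a procedure that must return a single maximizer;
   the hypothesis on K is only used to know that 'I_K is inhabited, and ties
   are broken arbitrarily. *)
Definition top_class (hK : (1 < K)%N) v : 'I_K :=
  [arg max_(k > Ordinal (ltnW hK)) v 0 k]%O.

(* Meant for 0 < N. *)
Definition top1_accuracy (hK : (1 < K)%N) (X : Type) (f : X -> 'rV[R]_K)
    (N : nat) (xs : 'I_N -> X) (ys : 'I_N -> 'I_K) : R :=
  #|[set i | top_class hK (f (xs i)) == ys i]|%:R / N%:R.

End Vectors.

Section ADSC.
Variables (R : realType) (K : nat) (hK : (1 < K)%N) (X : Type).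
Variables (T Pp Pm : X -> 'rV[R]_K) (eps lam m : R).
Implicit Types (x : X) (t j : 'I_K).

Definition penalty x : 'rV[R]_K :=
  (2 * eps)^-1 *: (logv (softmax (Pp x)) - logv (softmax (Pm x))).

Definition gap x t j : R := T x 0 t - T x 0 j.

Definition cost x t j : R := penalty x 0 j - penalty x 0 t.

(* Computed in the extended reals so that the minimum over the empty set is
   +oo; the clipped value lies between 0 and lam, so [fine] loses nothing. *)
Definition budget x : R :=
  let t := top_class hK (T x) in
  let a : \bar R := (\big[mine/+oo]_(j | (j != t) && (0 < cost x t j)%R)
                       ((gap x t j - m) / cost x t j)%:E)%E in
  fine (mine (maxe a 0%:E) lam%:E).

Definition served_at (l : R) x : 'rV[R]_K :=
  softmax (logv (softmax (T x)) + l *: penalty x).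

Definition served x : 'rV[R]_K := served_at (budget x) x.

End ADSC.

(* Main.v *)
Require Import Defs.
From HB Require Import structures.
From mathcomp Require Import all_boot all_order all_algebra.
From mathcomp Require Import mathcomp_extra boolp classical_sets reals.
From mathcomp Require Import constructive_ereal sequences exp.
From mathcomp Require Import ring.

Set Implicit Arguments.
Unset Strict Implicit.
Unset Printing Implicit Defensive.
Import Order.TTheory GRing.Theory Num.Theory.
Local Open Scope ring_scope.

(** After taking logarithms, the normalizing constants cancel and the served
    margin of the top class [t] over [j] is the affine function
    [gap j - l * c j] of the strength [l].  For [l > 0] and [c j > 0] it lies
    strictly below [gap j], so it is at least [min m (gap j)] exactly when
    [l <= (gap j - m) / c j]; in every other case the constraint is void.
    The budget is therefore the largest feasible strength. *)

Section Argmax.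
Context {R : realType} {K : nat}.
Implicit Types (v : 'rV[R]_K) (t j : 'I_K).

Lemma argmax_eq1P v t :
  argmax v = [set t]%SET <-> forall j, j != t -> v 0 j < v 0 t.
Proof.
split=> [vt j jt|vt].
  have /[!inE]/forallP tmax : t \in argmax v by rewrite vt inE.
  (* If [v 0 t <= v 0 j], then [j] is a maximizer too, hence lies in the singleton. *)
  rewrite ltNge; apply: contra jt => tj; rewrite -(finset.in_set1 _ t) -vt inE.
  by apply/forallP => k; apply: le_trans tj.
apply/setP => k; rewrite !inE; apply/forallP/eqP => [kmax|-> j].
  by apply/eqP; apply: contraLR (kmax t) => kt; rewrite -ltNge vt.
by have [->//|/vt/ltW] := eqVneq j t.
Qed.

Lemma top_class_eq (hK : (1 < K)%N) v t :
  argmax v = [set t]%SET -> top_class hK v = t.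
Proof.
move=> vt; apply/eqP; rewrite -(finset.in_set1 _ t) -vt inE /top_class.
by case: arg_maxP => // k _ kmax; apply/forallP => j; apply: kmax.
Qed.

(** The index [t] witnesses that ['I_K] is inhabited; over an empty index set the sum would be 0. *)
Lemma sum_expR_gt0 v t : 0 < \sum_j expR (v 0 j).
Proof.
rewrite (bigD1 t)//= ltr_pwDl ?expR_gt0// sumr_ge0// => j _.
exact: expR_ge0.
Qed.

Lemma softmax_gt0 v t : 0 < softmax v 0 t.
Proof. by rewrite mxE divr_gt0 ?expR_gt0// (sum_expR_gt0 v t). Qed.

Lemma ln_softmaxB v t j :
  ln (softmax v 0 t) - ln (softmax v 0 j) = v 0 t - v 0 j.
Proof.
have S0 := sum_expR_gt0 v t.
by rewrite !mxE !ln_div ?posrE ?expR_gt0// !expRK opprB addrA subrK.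
Qed.

(** Softmax keeps the differences of coordinates on the log scale, and [ln] is strictly increasing
    on positive reals. *)
Lemma argmax_softmax v t :
  argmax v = [set t]%SET -> argmax (softmax v) = [set t]%SET.
Proof.
move=> /argmax_eq1P vt; apply/argmax_eq1P => j /vt.
by rewrite -subr_gt0 -ln_softmaxB subr_gt0 ltr_ln ?posrE ?softmax_gt0.
Qed.

End Argmax.

Section Budget.
Context {R : realType} {K : nat} {hK : (1 < K)%N} {X : Type}.
Context {T Pp Pm : X -> 'rV[R]_K} {eps lam m : R}.
Implicit Types (x : X) (t j : 'I_K) (l : R).

Local Notation cost := (cost Pp Pm eps).
Local Notation served_at := (served_at T Pp Pm eps).
Local Notation budget := (budget hK T Pp Pm eps lam m).

Lemma ln_served_atB l x t j :
  ln (served_at l x 0 t) - ln (served_at l x 0 j) = gap T x t j - l * cost x t j.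
Proof.
(* The teacher gap is turned back into a difference of log-probabilities, so that both sides share
   the same atoms and a ring identity remains. *)
rewrite ln_softmaxB /gap -(ln_softmaxB (T x)) /cost.
rewrite [LHS]/= ![((_ + _ : 'rV_ _) _ _)]mxE ![(_ *: _ : 'rV_ _) _ _]mxE.
rewrite ![logv (softmax (T x)) _ _]mxE.
ring.
Qed.

(** Comparing the budget with an arbitrary [l] splits the clip and the minimum into separate bounds.
    The guard [0 < l] encodes the clip at 0: any [l <= 0] passes it whatever the quotients are. *)
Lemma le_budget x t l : 0 <= lam -> argmax (T x) = [set t]%SET ->
  l <= budget x <->
  l <= lam /\ (0 < l ->
    forall j, j != t -> 0 < cost x t j -> l <= (gap T x t j - m) / cost x t j).
Proof.
move=> lam0 Txt; rewrite /budget (top_class_eq hK Txt).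
set a := (\big[_/_]_(j | _) _)%E.
have b_fin : mine (maxe a 0%:E) lam%:E \is a fin_num.
  rewrite fin_numElt lt_min lt_max ltNyr orbT ltNyr/=.
  by rewrite gt_min ltry orbT.
rewrite -lee_fin fineK// le_min le_max !lee_fin.
have aP : reflect (forall j, j != t -> 0 < cost x t j ->
    l <= (gap T x t j - m) / cost x t j) (l%:E <= a)%E.
  rewrite /a; apply: (iffP (bigmin_geP _ _ _ _)) => [[_ la] j jt cj|la].
    by rewrite -lee_fin la// jt.
  (* The first goal is the comparison with the default value [+oo] of the minimum. *)
  by split=> [|j /andP[jt cj]]; rewrite ?leey// lee_fin la.
split=> [/andP[/orP la ->]|[-> la]]; last first.
  by rewrite andbT; case: (leP l 0) => [_|/la/aP->//]; rewrite orbT.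
by split=> // l0; case: la => [/aP//|]; rewrite leNgt l0.
Qed.

(** This equivalence gives both halves of optimality: taken at [l = budget x] it shows that the
    budget is feasible, and taken at any feasible [l] it bounds [l] by the budget. *)
Lemma feasible_le_budget x t l : 0 <= lam -> argmax (T x) = [set t]%SET ->
  0 <= l ->
  l <= budget x <->
  l <= lam /\ forall j, j != t ->
    Num.min m (gap T x t j) <= ln (served_at l x 0 t) - ln (served_at l x 0 j).
Proof.
move=> lam0 Txt l0; rewrite (le_budget _ lam0 Txt).
split=> -[llam lj]; split=> //.
  move=> j jt; rewrite ln_served_atB ge_min.
  have [cj|cj] := ltP 0 (cost x t j); last first.
    by rewrite [X in _ || X]lerBrDr gerDl mulr_ge0_le0 ?orbT.
  have [lgt0|l_le0] := ltP 0 l.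
    by rewrite lerBrDr -lerBrDl -ler_pdivlMr// lj.
  have -> : l = 0 by apply/eqP; rewrite eq_le l_le0.
  by rewrite mul0r subr0 lexx orbT.
move=> lgt0 j jt cj; have := lj _ jt; rewrite ln_served_atB ge_min.
have -> : (gap T x t j <= gap T x t j - l * cost x t j) = false.
  by apply/negbTE; rewrite -ltNge ltrBlDr ltrDl mulr_gt0.
by rewrite orbF ler_pdivlMr// lerBrDr addrC -lerBrDr.
Qed.

Lemma budget_ge0 x t : 0 <= lam -> argmax (T x) = [set t]%SET ->
  0 <= budget x.
Proof. by move=> lam0 Txt; apply/(le_budget _ lam0 Txt); rewrite ltxx. Qed.

End Budget.

Theorem proposition1 (R : realType) (K : nat) (hK : (1 < K)%N) (X : Type)
    (T Pp Pm : X -> 'rV[R]_K) (eps lam m : R)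
    (heps : 0 < eps) (hlam : 0 <= lam) (hm : 0 < m) :
  let pT := fun x : X => softmax (T x) in
  let phat := served hK T Pp Pm eps lam m in
  let phat_at := served_at T Pp Pm eps in
  let lamx := budget hK T Pp Pm eps lam m in
  (forall (x : X) (t : 'I_K), argmax (T x) = [set t]%SET ->
    [/\ (* (i) *)
        forall j : 'I_K, j != t ->
          Num.min m (gap T x t j) <= ln (phat x 0 t) - ln (phat x 0 j)
          /\ 0 < Num.min m (gap T x t j),
        (* (ii), per query *)
        argmax (phat x) = [set t]%SET /\ argmax (pT x) = [set t]%SET
      & (* (iii) *)
        let feasible := fun l : R =>
          0 <= l <= lam /\
          forall j : 'I_K, j != t ->
            Num.min m (gap T x t j)
              <= ln (phat_at l x 0 t) - ln (phat_at l x 0 j) in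
        feasible (lamx x) /\ (forall l : R, feasible l -> l <= lamx x)])
  /\ (* (ii), accuracy *)
  (forall (N : nat) (xs : 'I_N -> X) (ys : 'I_N -> 'I_K), (0 < N)%N ->
    (forall i : 'I_N, exists t : 'I_K, argmax (T (xs i)) = [set t]%SET) ->
    top1_accuracy hK phat xs ys = top1_accuracy hK pT xs ys).
Proof.
move=> pT phat phat_at lamx.
have gap_gt0 x t : argmax (T x) = [set t]%SET ->
    forall j, j != t -> 0 < Num.min m (gap T x t j).
  by move=> /argmax_eq1P Tt j jt; rewrite lt_min hm subr_gt0 Tt.
have lamx_ge0 x t : argmax (T x) = [set t]%SET -> 0 <= lamx x.
  exact: budget_ge0.
have margin x t (Txt : argmax (T x) = [set t]%SET) :
    lamx x <= lam /\ forall j, j != t ->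
      Num.min m (gap T x t j) <= ln (phat x 0 t) - ln (phat x 0 j).
  exact/(feasible_le_budget hlam Txt (lamx_ge0 _ _ Txt)).
have argmax_phat x t :
    argmax (T x) = [set t]%SET -> argmax (phat x) = [set t]%SET.
  move=> Txt; apply/argmax_eq1P => j jt.
  rewrite -ltr_ln ?posrE ?softmax_gt0// -subr_gt0.
  by apply: lt_le_trans (gap_gt0 _ _ Txt _ jt) _; apply: (margin _ _ Txt).2.
split=> [x t Txt|N xs ys _ xs_top].
  split=> [j jt||/=].
  - by split; [exact: (margin _ _ Txt).2|exact: gap_gt0].
  - by split; [exact: argmax_phat|exact: argmax_softmax].
  - split=> [|l [/andP[l0 llam] lj]].
      have [lamx_le lamxP] := margin _ _ Txt.
      by split; [rewrite (lamx_ge0 _ _ Txt) lamx_le|exact: lamxP].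
    by apply/(feasible_le_budget hlam Txt l0).
(* Uniqueness of the teacher argmax makes the tie-breaking of [top_class] irrelevant: both
   predictors select the same index on each input, so the counted sets coincide. *)
congr (_%:R / _); apply: eq_card => i; rewrite !inE.
have [t Txt] := xs_top i.
by rewrite (top_class_eq hK (argmax_phat _ _ Txt))
  (top_class_eq hK (argmax_softmax Txt)).
Qed.
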